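(* Let $p \geq 0$. Then for any simple graph $G$ with at least one edge, $$\xi_f(G) \geq 1 + \max\left\{\frac{\mathcal{E}_p^+(G)}{\mathcal{E}_p^-(G)}, \frac{\mathcal{E}_p^-(G)}{\mathcal{E}_p^+(G)}\right\}^{\frac{1}{|p - 1|}}.$$
   Context: $A_G$ is the adjacency matrix of $G$ with eigenvalues $\lambda_1\ge\cdots\ge\lambda_n$. For $p \ge 0$, $\mathcal{E}_p^+(G) = \sum_{\lambda_i > 0} \lambda_i^p$ and $\mathcal{E}_p^-(G) = \sum_{\lambda_i<0} |\lambda_i|^p$ (with multiplicity; for $p=0$ these count the positive and negative eigenvalues). A $d/r$-representation of $G$ is a family of rank-$r$ orthogonal projectors $P_v \in \mathbb{C}^{d\times d}$, $v \in V(G)$, with $P_vP_w = O$ for every edge $vw$; the projective rank is $\xi_f(G) = \inf\{d/r : G \text{ has a } d/r\text{-representation}\}$. *)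

(* Defs.v *)
From HB Require Import structures.
From mathcomp Require Import all_boot all_order all_algebra.
From mathcomp Require Import all_classical all_reals.
From mathcomp Require Import exp.
From mathcomp Require Import complex.
Set Implicit Arguments. Unset Strict Implicit. Unset Printing Implicit Defensive.
Import Order.TTheory GRing.Theory Num.Theory.
Local Open Scope ring_scope.

Definition simple_graph (n : nat) (G : rel 'I_n) : Prop :=
  symmetric G /\ irreflexive G.

Definition has_edge (n : nat) (G : rel 'I_n) : Prop := exists v w, G v w.

Definition adjmx (R : pzRingType) (n : nat) (G : rel 'I_n) : 'M[R]_n :=
  \matrix_(i, j) (G i j)%:R.

Definition eigenvalues_mult (R : realType) (n : nat) (A : 'M[R]_n) (s : seq R) : Prop :=
  char_poly A = \prod_(x <- s) ('X - x%:P).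

Definition Eplus (R : realType) (p : R) (s : seq R) : R :=
  \sum_(x <- s | 0 < x) powR x p.
Definition Eminus (R : realType) (p : R) (s : seq R) : R :=
  \sum_(x <- s | x < 0) powR (- x) p.

Definition adjointmx (R : rcfType) (d : nat) (P : 'M[R[i]]_d) : 'M[R[i]]_d :=
  (map_mx (@conjc R) P)^T.

Definition orth_projector (R : rcfType) (d r : nat) (P : 'M[R[i]]_d) : Prop :=
  P *m P = P /\ adjointmx P = P /\ \rank P = r.

Definition dr_representation (R : rcfType) (n : nat) (G : rel 'I_n) (d r : nat) : Prop :=
  exists P : 'I_n -> 'M[R[i]]_d,
    (forall v, orth_projector r (P v)) /\
    (forall v w, G v w -> P v *m P w = 0).

Definition projective_rank (R : realType) (n : nat) (G : rel 'I_n) : R :=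
  inf [set x : R | exists d r : nat, (0 < r)%N /\ dr_representation R G d r
                                     /\ x = d%:R / r%:R].

(* Main.v *)
(** Write [kappa = d / r], [K = kappa - 1], and split the adjacency matrix as
    [A = B - C] with [B, C] positive semidefinite and [B C = 0].  A
    [d/r]-representation gives a projector [P = sum_v e_v e_v^* (x) P_v] on
    [C^n (x) C^d] with [P (A (x) 1) P = 0], i.e. [P B P = P C P], and with partial
    trace [r] at every vector of an eigenbasis of [A].  Diagonalise [P B P], with
    eigenvectors [e_k] and eigenvalues [z_k], and let [m_ik] be the mass of [P e_k]
    on the eigenvector [i] of [A], of eigenvalue [l_i].  Then [sum_i m_ik <= 1],
    [sum_i m_ik l_i = 0], [sum_k m_ik = r], [sum_(l_i > 0) m_ik l_i = z_k], and
    Bessel's inequality for the orthogonal vectors [B^(1/2) P e_k] gives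
    [sum_k m_ik l_i / z_k <= d] whenever [l_i > 0].  From here on only tangent lines
    of [x^p] are needed: for each [k], those at [kappa z_k / K] (negative [l_i]) and
    [kappa z_k] (positive [l_i]) compare the energies with [sum_k z_k^p]; those at
    [l_i / kappa] compare [sum_k z_k^p] with the positive energy.  These points are
    where equality holds for complete graphs.  The result is
    [E^- <= K^(1-p) E^+] for [p <= 1] and the reverse for [p >= 1]; replacing [A] by
    [- A] exchanges the two energies. *)
Require Import Defs.
From HB Require Import structures.
From mathcomp Require Import all_boot all_order all_algebra.
From mathcomp Require Import all_classical all_reals.
From mathcomp Require Import exp.
From mathcomp Require Import complex spectral lra ring.
From mathcomp Require mxtens.
Import Order.TTheory GRing.Theory Num.Theory.
Local Open Scope ring_scope.

(** * Tangent lines of powers and the scalar estimate *)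

Lemma bernoulli_powR (R : realType) (s q : R) :
  0 <= s -> s <= 1 -> 0 < q -> powR q s <= 1 - s + s * q.
Proof.
move=> s0 s1 q0.
have [->|sn0] := eqVneq s 0; first by rewrite powRr0; lra.
have [sq0|] := ltP 0 (1 - s + s * q); last by nra.
set w := _ - _ + _ in sq0 *.
rewrite -(lnK (x := w)) ?posrE // /powR gt_eqF // ler_expR.
(* Concavity of ln: average [ln x <= x - 1] at [1 / w] and [q / w] with weights [1 - s] and [s]. *)
have e1 : - ln w <= w^-1 - 1.
  have w1 : 0 < w^-1 by rewrite invr_gt0.
  have := @le_ln1Dx R (w^-1 - 1); rewrite addrCA subrr addr0 lnV ?posrE //; apply.
  by rewrite -subr_gt0 opprK addrNK.
have e2 : ln q - ln w <= q / w - 1.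
  have w1 : 0 < q / w by rewrite divr_gt0.
  have := @le_ln1Dx R (q / w - 1); rewrite addrCA subrr addr0 ln_div ?posrE //; apply.
  by rewrite -subr_gt0 opprK addrNK.
have e3 : (1 - s) * (w^-1 - 1) + s * (q / w - 1) = 0.
  by rewrite /w; field; rewrite gt_eqF.
nra.
Qed.

(** The concave case with exponent [s^-1] at the point [q ^ s], multiplied by [s]. *)
Lemma bernoulli_powR_ge1 (R : realType) (s q : R) :
  1 <= s -> 0 < q -> 1 - s + s * q <= powR q s.
Proof.
move=> s1 q0; have s0 : 0 < s by lra.
have := @bernoulli_powR R s^-1 (powR q s).
rewrite -powRrM mulfV ?gt_eqF // (powRr1 (ltW q0)) invr_ge0 (ltW s0) invf_le1 // powR_gt0 //.
move=> /(_ isT s1 isT); rewrite -(ler_pM2l s0) mulrDr mulrBr mulr1 mulfV ?gt_eqF //.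
by rewrite mulrA mulfV ?gt_eqF //; lra.
Qed.

(** Bernoulli at [x / y], scaled by [y ^ s]: the right-hand side is [e] times the tangent line of
    the power at [y]. *)
Lemma powR_tangent (R : realType) (e s x y : R) :
  0 <= s -> (0 <= e /\ s <= 1 \/ e <= 0 /\ 1 <= s) -> 0 < x -> 0 < y ->
  e * powR x s <= e * (powR y s * (1 - s + s * (x / y))).
Proof.
move=> s0 es x0 y0; have xy0 : 0 < x / y by rewrite divr_gt0.
have -> : powR x s = powR y s * powR (x / y) s.
  by rewrite -powRM ?ltW // mulrCA mulfV ?mulr1 // gt_eqF.
rewrite ![e * (_ * _)]mulrCA ler_pM2l ?powR_gt0 //.
case: es => [[e0 s1]|[e0 s1]]; first by rewrite ler_wpM2l // bernoulli_powR.
by rewrite ler_wnM2l // bernoulli_powR_ge1.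
Qed.

(* The sign of [e] selects the direction of the inequality, so that the concave case
   ([s <= 1], [e = 1]) and the convex case ([s >= 1], [e = -1]) share one proof. *)
Lemma power_sum_bound (R : realType) (I T : finType) (l : I -> R) (m : I -> T -> R)
    (d r s e : R) (z := fun k => \sum_(i | 0 < l i) m i k * l i) :
  0 < r -> r < d -> 0 <= s -> (0 <= e /\ s <= 1 \/ e <= 0 /\ 1 <= s) ->
  (forall i k, 0 <= m i k) -> (forall k, \sum_i m i k <= 1) ->
  (forall k, \sum_i m i k * l i = 0) -> (forall i, \sum_k m i k = r) ->
  (forall i, 0 < l i -> \sum_(k | 0 < z k) m i k * l i / z k <= d) ->
  e * \sum_(i | l i < 0) powR (- l i) s <=
  e * (powR (d / r - 1) (1 - s) * \sum_(i | 0 < l i) powR (l i) s).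
Proof.
move=> r0 rd s0 es m0 msum ml mr bessel.
have es0 : 0 <= e * (1 - s) by case: es => -[]; nra.
set ka := d / r; set K := ka - 1.
have K0 : 0 < K by rewrite subr_gt0 ltr_pdivlMr // mul1r.
have ka0 : 0 < ka by rewrite (lt_trans K0) // /K; lra.
have kar : ka * r = d by rewrite divfK // gt_eqF.
have negz k : \sum_(i | l i < 0) m i k * - l i = z k.
  apply/esym/eqP; rewrite -subr_eq0 -[X in _ == X](ml k) /z big_mkcond.
  rewrite [X in _ - X]big_mkcond -sumrB; apply/eqP/eq_bigr => i _.
  by case: ltgtP => [||<-]; rewrite ?mulrN ?opprK ?subr0 ?add0r ?mulr0.
have z0 k : 0 <= z k by apply: sumr_ge0 => i l0; rewrite mulr_ge0 ?m0 ?ltW.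
(* If [z k = 0], the positive and the negative part of the balanced sum both vanish, so all mass
   lies on zero eigenvalues. *)
have mz i k : l i != 0 -> ~~ (0 < z k) -> m i k = 0.
  move=> li; rewrite lt_def z0 andbT negbK => /eqP zk.
  have [l0|l0] := ltP 0 (l i).
    have : \sum_(i | 0 < l i) m i k * l i == 0 by apply/eqP.
    rewrite psumr_eq0 => [/allP/(_ i)|j lj]; last by rewrite mulr_ge0 ?m0 ?ltW.
    by rewrite mem_index_enum l0 mulf_eq0 (negPf li) orbF => /(_ isT)/eqP.
  have {}l0 : l i < 0 by rewrite lt_neqAle li.
  have : \sum_(i | l i < 0) m i k * - l i == 0 by rewrite negz zk.
  rewrite psumr_eq0 => [/allP/(_ i)|j lj]; last by rewrite mulr_ge0 ?m0 ?oppr_ge0 ?ltW.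
  by rewrite mem_index_enum l0 mulf_eq0 oppr_eq0 (negPf li) orbF => /(_ isT)/eqP.
(* Positive eigenvalues are shrunk by [K], so that one tangent point serves both signs. The value at
   [l i = 0] is 0 even for [s = 0], where [powR 0 0 = 1]. *)
pose h i := if 0 < l i then powR K (- s) * powR (l i) s
            else if l i < 0 then powR (- l i) s else 0.
(* Tangents at [v = kappa z / K] for negative [l i] and at [K v] for positive ones. *)
have step1 k : 0 < z k ->
    e * \sum_i m i k * h i <= e * powR (ka / K * z k) s.
  move=> zk; set v := ka / K * z k.
  have v0 : 0 < v by rewrite mulr_gt0 // divr_gt0.
  (* Both weighted sums equal [z k], and [1 / (K v) + 1 / v = 1 / z k]; this fixes the choice of
     [v]. *)
  pose t i := (if 0 < l i then m i k * l i else 0) / (K * v)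
            + (if l i < 0 then m i k * - l i else 0) / v.
  have tsum : \sum_i t i = 1.
    rewrite big_split /= -!mulr_suml -!big_mkcond /= negz -/(z k).
    by rewrite /v /K; field; rewrite -/K !gt_eqF.
  have hi i : e * (m i k * h i) <= e * powR v s * ((1 - s) * m i k + s * t i).
    rewrite /h /t; case: ltgtP => li.
    - have -> : powR K (- s) * powR (l i) s = powR (l i / K) s.
        by rewrite powRM ?invr_ge0 ?ltW // mulrC -(powR_inv1 (ltW K0)) -powRrM mulN1r.
      have := powR_tangent _ _ _ _ _ s0 es (divr_gt0 li K0) v0.
      move=> /(ler_wpM2l (m0 i k)); rewrite mulrCA => /le_trans; apply.
      by rewrite le_eqVlt; apply/orP; left; apply/eqP; field; rewrite !gt_eqF.
    - have nli : 0 < - l i by rewrite oppr_gt0.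
      have := powR_tangent _ _ _ _ _ s0 es nli v0.
      move=> /(ler_wpM2l (m0 i k)); rewrite mulrCA => /le_trans; apply.
      by rewrite le_eqVlt; apply/orP; left; apply/eqP; field; rewrite !gt_eqF.
    - rewrite !(mul0r, mulr0, addr0).
      have -> : e * powR v s * ((1 - s) * m i k) = e * (1 - s) * (powR v s * m i k) by ring.
      by rewrite mulr_ge0 // mulr_ge0 ?powR_ge0.
  rewrite mulr_sumr (le_trans (ler_sum _ (fun i _ => hi i))) //.
  rewrite -mulr_sumr big_split /= -!mulr_sumr tsum.
  have p0 := powR_ge0 v s.
  rewrite -subr_ge0.
  have -> : e * powR v s - e * powR v s * ((1 - s) * \sum_i m i k + s * 1)
    = e * (1 - s) * (powR v s * (1 - \sum_i m i k)) by ring.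
  by rewrite mulr_ge0 // mulr_ge0 // subr_ge0.
(* [z ^ s] averaged with the weights [m i k * l i / z k], which sum to 1 by definition
   of [z k], using the tangent at [l i / kappa]. *)
have step2 k : 0 < z k -> e * powR (z k) s <= \sum_(i | 0 < l i)
    e * powR (l i / ka) s * ((1 - s) * (m i k * l i / z k) + s * ka * m i k).
  move=> zk; have zn0 : z k != 0 by rewrite gt_eqF.
  rewrite -[X in X <= _]mul1r -[X in X * _ <= _](mulfV zn0).
  rewrite {1}/z !mulr_suml; apply: ler_sum => i li.
  have y0 : 0 < l i / ka by rewrite divr_gt0.
  have w0 : 0 <= m i k * l i / z k by rewrite !mulr_ge0 ?invr_ge0 ?m0 ?ltW.
  have := ler_wpM2l w0 (powR_tangent _ _ _ _ _ s0 es zk y0).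
  move=> /le_trans; apply.
  by rewrite le_eqVlt; apply/orP; left; apply/eqP; field; rewrite !gt_eqF.
have step3 : e * \sum_(k | 0 < z k) powR (z k) s <=
    e * (d * \sum_(i | 0 < l i) powR (l i / ka) s).
  rewrite mulr_sumr (le_trans (ler_sum _ step2)) // exchange_big /=.
  rewrite [e * (d * _)]mulrA !mulr_sumr; apply: ler_sum => i li.
  rewrite -mulr_sumr big_split /= -!mulr_sumr.
  have -> : \sum_(k | 0 < z k) m i k = r.
    rewrite -(mr i) [RHS](bigID (fun k => 0 < z k)) /= [X in _ = _ + X]big1 ?addr0 //.
    by move=> k; apply: mz; rewrite gt_eqF.
  (* As [kappa r = d] and [b <= d], the sign of [e * (1 - s)] lets [d] replace [(1 - s) b + s d]. *)
  rewrite -[s * ka * r]mulrA kar -subr_ge0.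
  set p := powR _ _; set b := \sum_(k | _) _.
  have -> : e * d * p - e * p * ((1 - s) * b + s * d)
     = e * (1 - s) * (p * (d - b)) by ring.
  by rewrite mulr_ge0 // mulr_ge0 ?powR_ge0 // subr_ge0 bessel.
(* Sum [step1] over [k]: each eigenvector has total mass [r], and indices with [z k = 0] only carry
   mass where [h] vanishes. *)
have step4 : e * (r * \sum_i h i) <=
     e * (powR (ka / K) s * \sum_(k | 0 < z k) powR (z k) s).
  have -> : r * \sum_i h i = \sum_k \sum_i m i k * h i.
    by rewrite exchange_big mulr_sumr; apply: eq_bigr => i _; rewrite -mulr_suml mr.
  rewrite (bigID (fun k => 0 < z k)) /= [X in _ + X]big1 ?addr0.
    rewrite mulr_sumr [powR _ _ * _]mulr_sumr [X in _ <= X]mulr_sumr.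
    apply: ler_sum => k zk; rewrite -(powRM _ (divr_ge0 (ltW ka0) (ltW K0)) (ltW zk)).
    exact: step1.
  move=> k zk; rewrite big1 // => i _; have [li|li] := eqVneq (l i) 0.
    by rewrite /h li ltxx mulr0.
  by rewrite mz ?mul0r.
set Ep := \sum_(i | 0 < l i) _; set Em := \sum_(i | l i < 0) _.
have hE : \sum_i h i = powR K (- s) * Ep + Em.
  rewrite /Ep /Em mulr_sumr [X in _ = X + _]big_mkcond [X in _ = _ + X]big_mkcond.
  rewrite -big_split /=.
  by apply: eq_bigr => i _; rewrite /h; case: ltgtP; rewrite ?addr0 ?add0r.
have yE : \sum_(i | 0 < l i) powR (l i / ka) s = powR ka (- s) * Ep.
  rewrite /Ep mulr_sumr; apply: eq_bigr => i li.
  by rewrite powRM ?invr_ge0 ?ltW // mulrC -(powR_inv1 (ltW ka0)) -powRrM mulN1r.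
have kE : powR (ka / K) s = powR ka s * powR K (- s).
  by rewrite powRM ?invr_ge0 ?ltW // -(powR_inv1 (ltW K0)) -powRrM mulN1r.
have K1 : powR K (1 - s) = K * powR K (- s).
  by rewrite powRD ?(powRr1 (ltW K0)) // (gt_eqF K0) implybT.
have kk : powR ka s * powR ka (- s) = 1 by rewrite powRN mulfV // gt_eqF ?powR_gt0.
(* Powers of [kappa] cancel between [step4] and [step3], leaving, up to [e],
   [K^-s Ep + Em <= kappa K^-s Ep]; then [kappa - 1 = K]. *)
have := ler_wpM2l (powR_ge0 (ka / K) s) step3.
rewrite ![powR (ka / K) s * (e * _)]mulrCA => /(le_trans step4).
rewrite hE yE kE K1.
have -> : e * (powR ka s * powR K (- s) * (d * (powR ka (- s) * Ep)))
   = r * (e * (ka * powR K (- s) * Ep) * (powR ka s * powR ka (- s))).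
  by rewrite -kar; ring.
by rewrite kk mulr1 mulrCA ler_pM2l // /K; lra.
Qed.

(** * Mass distributions from a compressed diagonal matrix *)

Local Open Scope sesquilinear_scope.

Lemma gram_diag_entry (C : numClosedFieldType) (p q : nat) (w : 'I_p -> C)
    (M : 'M[C]_(p, q)) (k l : 'I_q) :
  (M^t* *m diag_mx (\row_x w x) *m M) k l = \sum_x w x * ((M x k)^* * M x l).
Proof.
rewrite mul_mx_diag mxE; apply: eq_bigr => x _; rewrite !mxE.
by rewrite mulrA [_ * w x]mulrC.
Qed.

Lemma hermitian_eigenbasis (C : numClosedFieldType) (n : nat) (A : 'M[C]_n) :
  A^t* = A -> exists (U : 'M[C]_n) (D : 'rV[C]_n),
  [/\ U *m U^t* = 1%:M, U^t* *m U = 1%:M, forall i, D 0 i \is Num.real,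
      A = U *m diag_mx D *m U^t* & char_poly A = \prod_i ('X - (D 0 i)%:P)].
Proof.
move=> hA; have hermA : A \is hermsymmx.
  by apply/is_hermitianmxP; rewrite expr0 scale1r hA.
have /orthomx_spectralP := hermitian_normalmx hermA.
set P := spectralmx A; set D := spectral_diag A => AE.
have PU : P \is unitarymx := spectral_unitarymx A.
have PV := invmx_unitary PU; have Pu := spectral_unit A.
have VP : P^t* *m P = 1%:M by rewrite -PV mulVmx.
have PVK : P *m P^t* = 1%:M by rewrite -PV mulmxV.
exists (P^t* ), D; rewrite trmxCK; split => //.
- by move=> i; apply: (mxOverP (hermitian_spectral_diag_real hermA)).
- by rewrite -PV.
rewrite {1}AE.
have -> : char_poly (invmx P *m diag_mx D *m P) = char_poly (diag_mx D).
  rewrite /char_poly /char_poly_mx.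
  have -> : 'X%:M - map_mx polyC (invmx P *m diag_mx D *m P) =
     map_mx polyC (invmx P) *m ('X%:M - map_mx polyC (diag_mx D)) *m map_mx polyC P.
    rewrite mulmxBr mulmxBl -!map_mxM; congr (_ - _).
    by rewrite scalar_mxC -mulmxA -map_mxM mulVmx // map_mx1 mulmx1.
  rewrite !det_mulmx mulrAC -det_mulmx -map_mxM mulVmx // map_mx1 det1 mul1r //.
rewrite char_poly_trig ?diag_mx_is_trig //.
by apply: eq_bigr => i _; rewrite mxE eqxx mulr1n.
Qed.

(** Coordinates are taken in an eigenbasis, [f] giving the eigenvalue index. With [M = P E], zero
    mean is the diagonal of [M^t* L M = 0], the value of [z k] that of [M^t* Lp M = D], and the
    total mass comes from [M M^t* = P]. *)
Lemma compression_weights (C : numClosedFieldType) (N d : nat) (I : finType)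
    (f : 'I_N -> I) (l : I -> C) (P : 'M[C]_N) (r : C) :
  (forall i, l i \is Num.real) -> P^t* = P -> P *m P = P ->
  P *m diag_mx (\row_x l (f x)) *m P = 0 ->
  (forall i, \sum_(x | f x == i) P x x = r) ->
  (forall i, #|[pred x | f x == i]| = d) ->
  exists m : I -> 'I_N -> C, let z k := \sum_(i | 0 < l i) m i k * l i in
  [/\ forall i k, 0 <= m i k, forall k, \sum_i m i k <= 1,
      forall k, \sum_i m i k * l i = 0, forall i, \sum_k m i k = r &
      forall i, 0 < l i -> \sum_(k | 0 < z k) m i k * l i / z k <= d%:R].
Proof.
move=> lreal hP iP PlP trP fd.
pose lp i := if 0 < l i then l i else 0.
have lp0 i : 0 <= lp i by rewrite /lp; case: ifP => // /ltW.
pose Lp := diag_mx (\row_x lp (f x)).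
have hLp : Lp^t* = Lp.
  rewrite tr_diag_mx map_diag_mx; congr diag_mx; apply/rowP => x.
  by rewrite !mxE; apply/CrealP/ger0_real.
have hH : (P *m Lp *m P)^t* = P *m Lp *m P.
  by rewrite !trmx_mul !map_mxM hP hLp mulmxA.
have [E [D [EE1 EE2 Dreal HE _]]] := hermitian_eigenbasis _ _ _ hH.
pose M := P *m E.
have MS : M^t* = E^t* *m P by rewrite trmx_mul map_mxM hP.
have gl : M^t* *m diag_mx (\row_x l (f x)) *m M = 0.
  have -> : M^t* *m diag_mx (\row_x l (f x)) *m M =
      E^t* *m (P *m diag_mx (\row_x l (f x)) *m P) *m E by rewrite MS /M !mulmxA.
  by rewrite PlP mulmx0 mul0mx.
have glp : M^t* *m Lp *m M = diag_mx D.
  have -> : M^t* *m Lp *m M = E^t* *m (P *m Lp *m P) *m E by rewrite MS /M !mulmxA.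
  by rewrite HE !mulmxA EE2 mul1mx -mulmxA EE2 mulmx1.
have MM : M *m M^t* = P by rewrite MS /M mulmxA -[P *m E *m _]mulmxA EE1 mulmx1 iP.
pose m i k := \sum_(x | f x == i) `|M x k| ^+ 2.
have m0 i k : 0 <= m i k by apply: sumr_ge0 => x _; rewrite exprn_ge0.
have fsum (w : I -> C) k :
    \sum_i m i k * w i = \sum_x w (f x) * ((M x k)^* * M x k).
  rewrite [RHS](partition_big f xpredT) //=; apply: eq_bigr => i _.
  rewrite mulr_suml; apply: eq_bigr => x /eqP <-.
  by rewrite normCK mulrC [X in _ * X]mulrC.
have zE k : \sum_(i | 0 < l i) m i k * l i = D 0 k.
  have -> : \sum_(i | 0 < l i) m i k * l i = \sum_i m i k * lp i.
    by rewrite big_mkcond; apply: eq_bigr => i _; rewrite /lp; case: ifP; rewrite ?mulr0.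
  by rewrite fsum -(gram_diag_entry _ _ _ (fun x => lp (f x))) glp mxE eqxx mulr1n.
exists m => z; have {}zE k : z k = D 0 k by rewrite /z zE.
split => //.
(* [|P e_k|^2 <= 1], from [0 <= |e_k - P e_k|^2 = 1 - |P e_k|^2]. *)
- move=> k; have := fsum (fun=> 1) k.
  under eq_bigr do rewrite mulr1; move=> ->.
  under eq_bigr do rewrite mul1r.
  have q1 : \sum_x (E x k)^* * E x k = 1.
    have := congr1 (fun X : 'M_N => X k k) EE2; rewrite !mxE eqxx mulr1n => <-.
    by apply: eq_bigr => x _; rewrite !mxE.
  have q2 : \sum_x (M x k)^* * M x k = (M^t* *m M) k k.
    by rewrite mxE; apply: eq_bigr => x _; rewrite !mxE.
  have q3 : \sum_x (E x k)^* * M x k = (M^t* *m M) k k.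
    rewrite MS -mulmxA [P *m M]mulmxA iP mxE.
    by apply: eq_bigr => x _; rewrite !mxE.
  have q4 : \sum_x (M x k)^* * E x k = (M^t* *m M) k k.
    rewrite {2}/M mulmxA MS -[E^t* *m P *m P]mulmxA iP -MS mxE.
    by apply: eq_bigr => x _; rewrite !mxE.
  have : 0 <= \sum_x `|E x k - M x k| ^+ 2 by apply: sumr_ge0 => x _; rewrite exprn_ge0.
  have -> : \sum_x `|E x k - M x k| ^+ 2 =
      \sum_x (E x k)^* * E x k - \sum_x (E x k)^* * M x k
      - (\sum_x (M x k)^* * E x k - \sum_x (M x k)^* * M x k).
    rewrite -!sumrB; apply: eq_bigr => x _; rewrite normCK rmorphB /=; ring.
  by rewrite q1 q2 q3 q4 subrr subr0 subr_ge0.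
- by move=> k; rewrite fsum -(gram_diag_entry _ _ _ (fun x => l (f x))) gl mxE.
- move=> i; rewrite exchange_big -(trP i); apply: eq_bigr => x _.
  by rewrite -MM mxE; apply: eq_bigr => k _; rewrite !mxE normCK.
move=> i li.
(* Bessel, without square roots: with [w = sum_k c_k P e_k] one has [w_x = b] and
   [<w, B w> = b], so that [l_i b^2 <= b]. *)
have bes x : f x = i -> \sum_(k | 0 < z k) l i * (`|M x k| ^+ 2 / z k) <= 1.
  move=> fx; rewrite -mulr_sumr; set b := \sum_(k | _) _.
  have b0 : 0 <= b by apply: sumr_ge0 => k zk; rewrite divr_ge0 ?exprn_ge0 // ltW.
  pose c := \col_k (if 0 < z k then (M x k)^* / z k else 0).
  have cw : c^t* *m diag_mx D *m c = (M *m c)^t* *m Lp *m (M *m c).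
    have -> : (M *m c)^t* = c^t* *m M^t* by rewrite (trmx_mul M c) map_mxM.
    by rewrite -glp !mulmxA.
  have ew : (M *m c) x 0 = b.
    rewrite mxE [RHS]big_mkcond; apply: eq_bigr => k _; rewrite !mxE.
    by case: ifP => _; rewrite ?mulr0 // normCK mulrA.
  have ec : (c^t* *m diag_mx D *m c) 0 0 = b.
    have -> : D = \row_k D 0 k by apply/rowP => k; rewrite mxE.
    rewrite gram_diag_entry [RHS]big_mkcond; apply: eq_bigr => k _; rewrite !mxE.
    case: ifP => zk; last by rewrite !mulr0.
    rewrite -zE rmorphM /= conjCK normCK.
    have -> : ((z k)^-1)^* = (z k)^-1 by apply/CrealP; rewrite realV gtr0_real.
    by field; rewrite gt_eqF.
  have : b >= l i * (b * b).
    rewrite -[X in X >= _]ec cw (gram_diag_entry _ _ _ (fun x => lp (f x))).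
    rewrite (bigD1 x) //= ew fx /lp li (CrealP (ger0_real b0)) lerDl.
    apply: sumr_ge0 => y _; rewrite mulr_ge0 ?lp0 //.
    by rewrite mulrC mul_conjC_ge0.
  have [->|bn0] := eqVneq b 0; first by rewrite !mulr0 ler01.
  have bp : 0 < b by rewrite lt_def bn0.
  by rewrite mulrA -[X in _ <= X]mul1r ler_pM2r.
(* Add the Bessel bounds over the [d] coordinates in the fibre of [i]. *)
rewrite -(fd i) -sumr_const.
under eq_bigr do rewrite mulr_suml mulr_suml.
rewrite exchange_big /=; apply: ler_sum => x /eqP fx.
apply: le_trans (bes x fx); rewrite le_eqVlt; apply/orP; left; apply/eqP.
by apply: eq_bigr => k _; rewrite mulrAC mulrC.
Qed.

(** * The projector attached to a representation *)

(** In a full-rank factorisation [P = X Y], idempotence forces [Y X = 1]; the trace is cyclic. *)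
Lemma mxtrace_idem (F : fieldType) (d : nat) (P : 'M[F]_d) :
  P *m P = P -> \tr P = (\rank P)%:R.
Proof.
move=> iP; have XY := mulmx_base P.
have /row_fullP := col_base_full P; have /row_freeP := row_base_free P.
move: (col_base P) (row_base P) XY => X Y XY [Y' YY'] [X' X'X].
have YX : Y *m X = 1%:M.
  have : X' *m (X *m Y *m (X *m Y)) *m Y' = X' *m (X *m Y) *m Y' by rewrite XY iP.
  by rewrite !mulmxA X'X !mul1mx -!mulmxA YY' !mulmx1.
by rewrite -{1}XY mxtrace_mulC YX mxtrace1.
Qed.

Lemma mulmx_delta_delta (S : pzRingType) (n : nat) (A : 'M[S]_n) (v w : 'I_n) :
  delta_mx v v *m A *m delta_mx w w = A v w *: delta_mx v w.
Proof.
apply/matrixP => i j; rewrite !mxE (bigD1 w) //= big1 ?addr0; last first.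
  by move=> k kw; rewrite [X in _ * X]mxE (negPf kw) mulr0.
rewrite !mxE (bigD1 v) //= big1 ?addr0; last first.
  by move=> k kv; rewrite !mxE (negPf kv) andbF mul0r.
rewrite !mxE !eqxx /= !andbT; case: (i == v); case: (j == w);
  by rewrite /= ?(mul1r, mulr1, mul0r, mulr0).
Qed.

(** The first tensor factor is written in the eigenbasis of [A], which makes [A] tensor 1 diagonal.
    Compressing it gives terms with factors [A v u] and [Q v *m Q u], one of which vanishes. *)
Lemma block_projector (C : numClosedFieldType) (n d : nat) (U A : 'M[C]_n)
    (D : 'rV[C]_n) (Q : 'I_n -> 'M[C]_d) (r : C) (f := fun x => (@mxtens.mxtens_unindex n d x).1) :
  U *m U^t* = 1%:M -> U^t* *m U = 1%:M -> A = U *m diag_mx D *m U^t* ->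
  (forall v, (Q v)^t* = Q v) -> (forall v, Q v *m Q v = Q v) ->
  (forall v, \tr (Q v) = r) -> (forall v w, A v w != 0 -> Q v *m Q w = 0) ->
  exists P : 'M[C]_(n * d),
  [/\ P^t* = P, P *m P = P, P *m diag_mx (\row_x D 0 (f x)) *m P = 0,
      forall i, \sum_(x | f x == i) P x x = r &
      forall i, #|[pred x | f x == i]| = d].
Proof.
move=> UU1 UU2 AE hQ iQ tQ QQ.
pose E v := U^t* *m delta_mx v v *m U.
pose P := \sum_v mxtens.tensmx (E v) (Q v).
have fsum (F : 'I_(n * d) -> C) i :
    \sum_(x | f x == i) F x = \sum_(a < d) F (mxtens.mxtens_index (i, a)).
  rewrite (reindex (fun a : 'I_d => mxtens.mxtens_index (i, a))) /=.
    by apply: eq_bigl => a; rewrite /f mxtens.mxtens_indexK eqxx.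
  exists (fun x => (mxtens.mxtens_unindex x).2) => x.
    by rewrite mxtens.mxtens_indexK.
  rewrite inE /f => /eqP <-; rewrite -surjective_pairing.
  exact: mxtens.mxtens_unindexK.
have hE v : (E v)^t* = E v.
  rewrite /E !trmx_mul !map_mxM trmxCK trmx_delta map_delta_mx mulmxA //.
have mul w : P *m mxtens.tensmx w 1%:M *m P =
    \sum_v \sum_u mxtens.tensmx (E v *m w *m E u) (Q v *m Q u).
  rewrite /P !mulmx_suml; apply: eq_bigr => v _; rewrite mulmx_sumr.
  by apply: eq_bigr => u _; rewrite !mxtens.tensmx_mul mulmx1.
(* [w = 1] yields idempotence, [w = diag_mx D] yields the entries of [A]. *)
have EE v u w : E v *m w *m E u =
    (U *m w *m U^t* ) v u *: (U^t* *m delta_mx v u *m U).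
  rewrite scalemxAl scalemxAr -mulmx_delta_delta /E !mulmxA //.
exists P; split.
- rewrite /P raddf_sum /= raddf_sum; apply: eq_bigr => v _.
  have tC (X : 'M[C]_n) (Y : 'M[C]_d) :
      (mxtens.tensmx X Y)^t* = mxtens.tensmx (X^t* ) (Y^t* ).
    by apply/matrixP => x y; rewrite !mxE rmorphM.
  by apply: etrans (tC _ _) _; rewrite hE hQ.
- have -> : P *m P = P *m mxtens.tensmx 1%:M 1%:M *m P.
    congr (_ *m _); apply/esym; rewrite -[RHS]mulmx1; congr (_ *m _).
    apply/matrixP => i j; case: (mxtens.mxtens_indexP i) => i0 i1.
    case: (mxtens.mxtens_indexP j) => j0 j1; rewrite mxtens.tensmxE !mxE -natrM mulnb.
    by rewrite (can_eq (@mxtens.mxtens_indexK n d)) xpair_eqE.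
  rewrite mul /P; apply: eq_bigr => v _; rewrite (bigD1 v) //= big1 ?addr0.
    by rewrite EE mulmx1 UU1 mxE eqxx scale1r iQ.
  move=> u uv; rewrite EE mulmx1 UU1 mxE eq_sym (negPf uv) scale0r.
  exact: mxtens.tens0mx.
- have -> : diag_mx (\row_x D 0 (f x)) = mxtens.tensmx (diag_mx D) 1%:M.
    apply/matrixP => i j; case: (mxtens.mxtens_indexP i) => i0 i1.
    case: (mxtens.mxtens_indexP j) => j0 j1; rewrite mxtens.tensmxE !mxE /f.
    rewrite mxtens.mxtens_indexK (can_eq (@mxtens.mxtens_indexK n d)) xpair_eqE /=.
    by case: (i0 == j0); rewrite ?mulr0n ?mul0r ?mulr1n // mulr_natr.
  rewrite mul big1 // => v _; rewrite big1 // => u _; rewrite EE -AE.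
  have [->|/QQ ->] := eqVneq (A v u) 0; first by rewrite scale0r mxtens.tens0mx.
  exact: mxtens.tensmx0.
- move=> i; rewrite fsum.
  under eq_bigr => a _.
    rewrite /P summxE; under eq_bigr do rewrite mxtens.tensmxE; over.
  rewrite exchange_big /=.
  under eq_bigr do rewrite -mulr_sumr [X in _ * X](tQ _).
  rewrite -mulr_suml -summxE.
  have -> : \sum_v E v = 1%:M.
    rewrite /E -mulmx_suml -mulmx_sumr -UU2; congr (_ *m _).
    rewrite -[RHS]mulmx1; congr (_ *m _); apply/matrixP => a b.
    rewrite summxE (bigD1 a) //= big1 ?addr0; last first.
      by move=> c ca; rewrite mxE [a == c]eq_sym (negPf ca).
    by rewrite !mxE eqxx /= eq_sym.
  by rewrite mxE eqxx mul1r.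
(* The fibre is counted in [C], where [fsum] applies. *)
move=> i; apply/eqP; rewrite -(eqr_nat C) -sumr_const.
by rewrite fsum sumr_const card_ord.
Qed.

(** * Energy inequalities for a graph *)

(** The complex weights are nonnegative, hence real, so taking real parts preserves every relation
    and makes [powR] available. *)
Lemma real_compression_weights (R : realType) (N d : nat) (I : finType)
    (f : 'I_N -> I) (l : I -> R) (P : 'M[R[i]]_N) (r : nat) :
  P^t* = P -> P *m P = P ->
  P *m diag_mx (\row_x ((l (f x))%:C)%C) *m P = 0 ->
  (forall i, \sum_(x | f x == i) P x x = r%:R) ->
  (forall i, #|[pred x | f x == i]| = d) ->
  exists m : I -> 'I_N -> R, let z k := \sum_(i | 0 < l i) m i k * l i in
  [/\ forall i k, 0 <= m i k, forall k, \sum_i m i k <= 1,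
      forall k, \sum_i m i k * l i = 0, forall i, \sum_k m i k = r%:R &
      forall i, 0 < l i -> \sum_(k | 0 < z k) m i k * l i / z k <= d%:R].
Proof.
move=> hP iP PlP trP fd.
pose lC i := real_complex R (l i).
have lreal i : lC i \is Num.real by apply/complex_realP; exists (l i).
have [m [m0 m1 ml mr mb]] := compression_weights _ _ _ _ f lC P r%:R lreal hP iP PlP trP fd.
pose m' i k := complex.Re (m i k).
have mE i k : m i k = real_complex R (m' i k) by rewrite /m' RRe_real // ger0_real.
have lC0 i : (0 < lC i) = (0 < l i) by rewrite /lC ltcR.
pose z k := \sum_(i | 0 < l i) m' i k * l i.
have zE k : \sum_(i | 0 < lC i) m i k * lC i = real_complex R (z k).
  by rewrite (eq_bigl _ _ lC0) /z rmorph_sum; apply: eq_bigr => i _; rewrite mE rmorphM.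
exists m'; split => [i k|k|k|i|i li].
- by rewrite -ler0c -mE.
- by rewrite -lecR rmorph_sum /=; under eq_bigr do rewrite -mE; exact: m1.
- apply: complexI; rewrite rmorph_sum rmorph0 /=; apply: etrans (ml k).
  by apply: eq_bigr => i _; rewrite rmorphM mE.
- apply: complexI; rewrite rmorph_sum rmorph_nat /= -(mr i).
  by apply: eq_bigr => k _; rewrite mE.
have := mb i; rewrite lC0 => /(_ li).
rewrite -lecR rmorph_sum rmorph_nat /=; apply: le_trans.
rewrite le_eqVlt; apply/orP; left; apply/eqP.
apply: eq_big => k; first by rewrite zE ltcR.
by rewrite zE mE rmorphM rmorphM fmorphV.
Qed.

(** Diagonalisation takes place over [R[i]], while [s] lists roots over [R]; uniqueness of the
    linear factors of the characteristic polynomial matches them with multiplicity. *)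
Lemma adjacency_eigenbasis (R : realType) (n : nat) (G : rel 'I_n) (s : seq R) :
  symmetric G -> eigenvalues_mult (adjmx R G) s ->
  exists (U : 'M[R[i]]_n) (l : 'I_n -> R),
  [/\ U *m U^t* = 1%:M, U^t* *m U = 1%:M,
      adjmx R[i] G = U *m diag_mx (\row_i ((l i)%:C)%C) *m U^t* &
      perm_eq s [seq l i | i <- enum 'I_n]].
Proof.
move=> sG hs; have hA : (adjmx R[i] G)^t* = adjmx R[i] G.
  by apply/matrixP => i j; rewrite !mxE sG rmorph_nat.
have [U [D [U1 U2 Dr AE cE]]] := hermitian_eigenbasis _ _ _ hA.
pose l i := complex.Re (D 0 i).
have lE i : D 0 i = real_complex R (l i) by rewrite /l RRe_real.
exists U, l; split => //.
  by rewrite AE; congr (_ *m diag_mx _ *m _); apply/rowP => i; rewrite mxE lE.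
apply: (perm_map_inj (@complexI R)); rewrite -map_comp; apply: prod_XsubC_eq.
rewrite big_map [RHS]big_map big_enum /=.
under [RHS]eq_bigr do rewrite -lE.
rewrite -cE; have -> : adjmx R[i] G = map_mx (real_complex R) (adjmx R G).
  by apply/matrixP => i j; rewrite !mxE rmorph_nat.
rewrite -map_char_poly hs rmorph_prod /=.
by apply: eq_bigr => x _; rewrite rmorphB /= map_polyX map_polyC.
Qed.

(** The projectors at the ends of an edge have product zero, so their ranks add up to at most
    [d]. *)
Lemma dr_representation_double (R : realType) (n : nat) (G : rel 'I_n) (d r : nat) :
  has_edge G -> dr_representation R G d r -> (2 * r <= d)%N.
Proof.
move=> [v [w vw]] [P [hP PP]].
have [_ [_ rv]] := hP v; have [_ [_ rw]] := hP w.
by rewrite mul2n -addnn -{1}rv -{1}rw mulmx0_rank_max ?PP.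
Qed.

Lemma energy_bound (R : realType) (n : nat) (G : rel 'I_n) (d r : nat) (s : seq R)
    (p e : R) :
  symmetric G -> eigenvalues_mult (adjmx R G) s -> dr_representation R G d r ->
  (0 < r < d)%N -> 0 <= p -> (0 <= e /\ p <= 1 \/ e <= 0 /\ 1 <= p) ->
  e * Eminus p s <= e * (powR (d%:R / r%:R - 1) (1 - p) * Eplus p s) /\
  e * Eplus p s <= e * (powR (d%:R / r%:R - 1) (1 - p) * Eminus p s).
Proof.
move=> sG hs [Q [hQ QQ]] /andP[r0 rd] p0 ep.
have [U [l [U1 U2 AE sl]]] := adjacency_eigenbasis _ _ _ _ sG hs.
have tQ v : \tr (Q v) = r%:R.
  by have [iQ [_ <-]] := hQ v; exact: mxtrace_idem.
have aQ v : (Q v)^t* = Q v.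
  by have [_ [aQ _]] := hQ v; rewrite -[RHS]aQ /adjointmx map_trmx.
have QQ' v w : adjmx R[i] G v w != 0 -> Q v *m Q w = 0.
  by rewrite mxE; case: (boolP (G v w)) => [/QQ //|_]; rewrite eqxx.
have [P [hP iP PlP trP fd]] := block_projector _ _ _ _ _ _ Q r%:R
  U1 U2 AE aQ (fun v => proj1 (hQ v)) tQ QQ'.
pose f x := (@mxtens.mxtens_unindex n d x).1.
(* Left general in [l'] to serve both [l] and [- l] with the same [P]. *)
have half (l' : 'I_n -> R) :
    P *m diag_mx (\row_x ((l' (f x))%:C)%C) *m P = 0 ->
    e * \sum_(i | l' i < 0) powR (- l' i) p <=
    e * (powR (d%:R / r%:R - 1) (1 - p) * \sum_(i | 0 < l' i) powR (l' i) p).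
  move=> Pl; have [m [m0 m1 ml mr mb]] := real_compression_weights _ _ _ _ f l' P r hP iP Pl trP fd.
  by apply: power_sum_bound mb; rewrite ?ltr0n ?ltr_nat.
have Pl : P *m diag_mx (\row_x ((l (f x))%:C)%C) *m P = 0.
  by rewrite -[RHS]PlP; congr (_ *m diag_mx _ *m _); apply/rowP => x; rewrite !mxE.
have PNl : P *m diag_mx (\row_x ((- l (f x))%:C)%C) *m P = 0.
  have -> : \row_x ((- l (f x))%:C)%C = - \row_x ((l (f x))%:C)%C.
    by apply/rowP => x; rewrite !mxE rmorphN.
  by rewrite linearN /= mulmxN mulNmx Pl oppr0.
have EpE : Eplus p s = \sum_(i | 0 < l i) powR (l i) p.
  by rewrite /Eplus (perm_big _ sl) big_map big_enum_cond.
have EmE : Eminus p s = \sum_(i | l i < 0) powR (- l i) p.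
  by rewrite /Eminus (perm_big _ sl) big_map big_enum_cond.
rewrite EpE EmE; split; first exact: half.
have := half (fun i => - l i) PNl.
under eq_bigl do rewrite oppr_lt0.
under eq_bigr do rewrite opprK.
by under [X in _ <= e * (_ * X)]eq_bigl do rewrite oppr_gt0.
Qed.

Lemma energy_ratio_bound (R : realType) (n : nat) (G : rel 'I_n) (d r : nat)
    (s : seq R) (p : R) :
  symmetric G -> eigenvalues_mult (adjmx R G) s -> dr_representation R G d r ->
  (0 < r < d)%N -> 0 <= p ->
  Num.max (Eplus p s / Eminus p s) (Eminus p s / Eplus p s) <=
  powR (d%:R / r%:R - 1) `|p - 1|.
Proof.
move=> sG hs hrep rd p0; set K := d%:R / r%:R - 1.
have K0 : 0 < K.
  by move/andP: rd => [r0 rd]; rewrite subr_gt0 ltr_pdivlMr ?ltr0n // mul1r ltr_nat.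
have Ep0 : 0 <= Eplus p s by apply: sumr_ge0 => x _; rewrite powR_ge0.
have Em0 : 0 <= Eminus p s by apply: sumr_ge0 => x _; rewrite powR_ge0.
(* For [b = 0] the quotient is 0 by convention, hence the condition [0 <= c]. *)
have div (a b c : R) : 0 <= b -> 0 <= c -> a <= c * b -> a / b <= c.
  rewrite le_eqVlt => /orP[/eqP <-|b0] c0 ab; first by rewrite invr0 mulr0.
  by rewrite ler_pdivrMr.
have pK := powR_ge0 K `|p - 1|.
rewrite ge_max; case: (leP p 1) => p1.
  have [] := energy_bound _ _ _ _ _ s p 1 sG hs hrep rd p0 (or_introl (conj ler01 p1)).
  have -> : `|p - 1| = 1 - p by rewrite distrC ger0_norm // subr_ge0.
  by rewrite !mul1r => h1 h2; rewrite !div ?powR_ge0.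
have e1 : (-1 : R) <= 0 by rewrite lerN10.
have [] := energy_bound _ _ _ _ _ s p (-1) sG hs hrep rd p0 (or_intror (conj e1 (ltW p1))).
have -> : `|p - 1| = p - 1 by rewrite gtr0_norm // subr_gt0.
have KK : powR K (p - 1) * powR K (1 - p) = 1.
  by rewrite -[1 - p]opprB powRN mulfV // gt_eqF ?powR_gt0.
rewrite !mulN1r !lerN2 => h1 h2; apply/andP; split; apply: div; rewrite ?powR_ge0 //.
  by move/(ler_wpM2l (powR_ge0 K (p - 1))): h1; rewrite mulrA KK mul1r.
by move/(ler_wpM2l (powR_ge0 K (p - 1))): h2; rewrite mulrA KK mul1r.
Qed.

(** * Passage to the infimum *)

(** Ensures that the infimum is taken over a nonempty set. *)
Lemma coordinate_representation (R : rcfType) (n : nat) (G : rel 'I_n) :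
  irreflexive G -> dr_representation R G n 1.
Proof.
move=> iG; exists (fun v => delta_mx v v); split => [v|v w vw].
  split; first by rewrite mul_delta_mx.
  by split; [rewrite /adjointmx map_delta_mx trmx_delta|exact: mxrank_delta].
by rewrite mul_delta_mx_0 //; apply: contraTneq vw => ->; rewrite iG.
Qed.

Theorem theorem3p1 (R : realType) (p : R) (hp : 0 <= p)
  (n : nat) (G : rel 'I_n) (hG : simple_graph G) (hE : has_edge G)
  (s : seq R) (hs : eigenvalues_mult (adjmx R G) s) :
  1 + powR (Num.max (Eplus p s / Eminus p s) (Eminus p s / Eplus p s))
           (`|p - 1|)^-1
  <= projective_rank R G.
Proof.
case: hG => sG iG; apply: lb_le_inf.
  exists (n%:R / 1%:R), n, 1%N; split => //; split => //.
  exact: coordinate_representation.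
move=> _ [d [r [r0 [hrep ->]]]].
have dr := dr_representation_double _ _ _ _ _ hE hrep.
have rd : (0 < r < d)%N.
  by rewrite r0 (leq_trans _ dr) // mul2n -addnn -[X in (X < _)%N]addn0 ltn_add2l.
have K1 : 1 <= d%:R / r%:R - 1 :> R.
  by rewrite lerBrDr ler_pdivlMr ?ltr0n // -[1 + 1]/(2%:R) -natrM ler_nat.
have K0 : 0 <= d%:R / r%:R - 1 :> R by rewrite (le_trans ler01).
rewrite addrC -lerBrDr.
(* At [p = 1] the exponent is [0^-1 = 0], so the power is 1 and the claim is [K1], which comes from
   the edge. *)
have [->|p1] := eqVneq p 1; first by rewrite subrr normr0 invr0 powRr0.
have := energy_ratio_bound _ _ _ _ _ s p sG hs hrep rd hp.
set x := Num.max _ _ => hx.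
have x0 : 0 <= x.
  rewrite /x le_max; apply/orP; left; apply: divr_ge0;
    by apply: sumr_ge0 => y _; rewrite powR_ge0.
have := ge0_ler_powR (_ : 0 <= (`|p - 1|)^-1) _ _ hx.
rewrite -powRrM mulfV ?normr_eq0 ?subr_eq0 // powRr1 //; apply.
- by rewrite invr_ge0.
- by rewrite nnegrE.
- by rewrite nnegrE powR_ge0.
Qed.
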